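(* With the notation of the context, let $B:\mathbb R\to\mathbb C^{p\times p}$ be continuous, with $|B|\in L^1([t_0,\infty))$, and suppose that there are constants $\nu^\pm<1$ such that $\int_{I_i^+}|B(s)|ds\le\nu^+$ and $\int_{I_i^-}|B(s)|ds\le\nu^-$ for all $i\in\mathbb Z$. Then there exists a homeomorphism between $\mathbb C^p$ and the bounded solutions of $$u'(t)=B(t)u(\gamma(t)).$$ Moreover, any solution $u$ converges to some $\hat u\in\mathbb C^p$ as $t\to\infty$, and for every $\hat u\in\mathbb C^p$ there exists a unique solution $u$ of this equation such that $u(t)\to\hat u$ as $t\to\infty$.
   Context: Fix a norm $|\cdot|$ on $\mathbb C^p$ and the induced matrix norm. Let $\{t_i\}_{i\in\mathbb Z},\{\zeta_i\}_{i\in\mathbb Z}$ be real sequences with $t_i<t_{i+1}$, $t_i\le\zeta_i\le t_{i+1}$, $t_i\to\pm\infty$ as $i\to\pm\infty$. Put $I_i=[t_i,t_{i+1})$, $\gamma(t)=\zeta_i$ for $t\in I_i$, $I_i^+=[t_i,\zeta_i]$, $I_i^-=(\zeta_i,t_{i+1})$. A solution of $u'(t)=B(t)u(\gamma(t))$ on an interval $I$ is a continuous function $u$ on $I$, differentiable except possibly at the points $t_i\in I$, where one-sided derivatives exist, satisfying the equation on each $(t_i,t_{i+1})\subset I$ and with the right derivative at the points $t_i\in I$. Solutions are considered on $[t_0,\infty)$, and bounded solutions carry the norm $\|u\|=\sup_{s\ge t_0^*}|u(s)|$, $t_0^*=\min\{t_0,\gamma(t_0)\}$. *)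

(* Defs.v *)
From mathcomp Require Import all_boot all_order all_algebra.
From mathcomp Require Import complex.
From mathcomp Require Import all_classical all_reals all_analysis.

Set Implicit Arguments.
Unset Strict Implicit.
Unset Printing Implicit Defensive.

Import Order.TTheory GRing.Theory Num.Theory.
Import numFieldNormedType.Exports.

Local Open Scope classical_set_scope.
Local Open Scope ring_scope.
Local Open Scope complex_scope.

(* [Normc.normc] is the real-valued modulus on [R[i]].  Nonnegativity
   of [N] and [N 0 = 0] follow from the three conditions. *)
Definition is_norm (R : realType) (p : nat) (N : 'cV[R[i]]_p -> R) : Prop :=
  [/\ forall x y, N (x + y) <= N x + N y,
      forall (a : R[i]) x, N (a *: x) = Normc.normc a * N x
    & forall x, N x = 0 -> x = 0].

Definition induced_norm (R : realType) (p : nat) (N : 'cV[R[i]]_p -> R)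
    (A : 'M[R[i]]_p) : R :=
  sup [set N (A *m x) | x in [set x | N x <= 1]].

Definition norm_cvg (R : realType) (V : zmodType) (N : V -> R)
    (F : set_system R) (u : R -> V) (l : V) : Prop :=
  N (u s - l) @[s --> F] --> (0 : R).

Definition diff_quot (R : realType) (p : nat) (u : R -> 'cV[R[i]]_p)
    (x s : R) : 'cV[R[i]]_p := ((s - x)^-1)%:C *: (u s - u x).

Definition admissible_grid (R : realType) (t zeta : int -> R) : Prop :=
  [/\ forall i, t i < t (i + 1),
      forall i, t i <= zeta i <= t (i + 1),
      t n%:Z @[n --> \oo] --> +oo
    & t (- n%:Z) @[n --> \oo] --> -oo].

(* The argument deviation: it is determined by [t] and [zeta]. *)
Definition is_gamma (R : realType) (t zeta : int -> R) (gamma : R -> R) : Prop :=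
  forall i x, t i <= x < t (i + 1) -> gamma x = zeta i.

(* A function on [t_0, +oo[ is encoded as the function on the whole line that
   extends it by 0, so that equality of encodings is equality on [t_0, +oo[.
   Under [admissible_grid] and [is_gamma], [gamma] maps [t_0, +oo[ to itself,
   so the equation never reads a value of [u] below [t_0]. *)
Definition is_solution (R : realType) (p : nat) (N : 'cV[R[i]]_p -> R)
    (t : int -> R) (gamma : R -> R) (B : R -> 'M[R[i]]_p)
    (u : R -> 'cV[R[i]]_p) : Prop :=
  [/\ forall x : R, x < t 0 -> u x = 0,
      forall x : R, t 0 <= x ->
        norm_cvg N (within `[t 0, +oo[ (nbhs x)) u (u x),
      forall (i : int) (x : R), 0 <= i -> t i < x < t (i + 1) ->
        norm_cvg N x^' (diff_quot u x) (B x *m u (gamma x)),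
      forall i : int, 0 <= i ->
        norm_cvg N (t i)^'+ (diff_quot u (t i)) (B (t i) *m u (gamma (t i)))
    & forall i : int, 0 < i -> exists l, norm_cvg N (t i)^'- (diff_quot u (t i)) l].

(* Equal to [t 0] on an admissible grid, since [gamma (t 0) = zeta 0]. *)
Definition tstar (R : realType) (t : int -> R) (gamma : R -> R) : R :=
  Num.min (t 0) (gamma (t 0)).

Definition bounded_solutions (R : realType) (p : nat)
    (N : 'cV[R[i]]_p -> R) (t : int -> R) (gamma : R -> R)
    (B : R -> 'M[R[i]]_p) : set (R -> 'cV[R[i]]_p) :=
  [set u | is_solution N t gamma B u /\
           exists M, forall s, tstar t gamma <= s -> N (u s) <= M].

Definition supnorm (R : realType) (p : nat) (N : 'cV[R[i]]_p -> R)
    (a : R) (u : R -> 'cV[R[i]]_p) : R :=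
  sup [set N (u s) | s in `[a, +oo[].

Definition dist_continuous (R : realType) (X Y : Type) (dX : X -> X -> R)
    (dY : Y -> Y -> R) (A : set X) (f : X -> Y) : Prop :=
  forall x, A x -> forall e, 0 < e ->
    exists2 d, 0 < d & forall x', A x' -> dX x x' < d -> dY (f x) (f x') < e.

Definition homeomorphic (R : realType) (X Y : Type) (dX : X -> X -> R)
    (dY : Y -> Y -> R) (A : set X) (D : set Y) : Prop :=
  exists (f : X -> Y) (g : Y -> X),
    [/\ forall x, A x -> D (f x) /\ g (f x) = x,
        forall y, D y -> A (g y) /\ f (g y) = y,
        dist_continuous dX dY A f
      & dist_continuous dY dX D g].

(* Main.v *)
(** On [t_n, t_{n+1}] the right-hand side only involves the vector u(zeta_n), so
    with A' = B the equation integrates to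
      u(x) = u(zeta_n) + (A(x) - A(zeta_n)) u(zeta_n).
    The smallness of B on I_n^+ makes 1 + A(t_n) - A(zeta_n) injective, hence
    invertible, so that every u(t_0) extends to exactly one solution.  Put G' = |B|.
    A discrete Gronwall argument gives
      |u(x)| <= |u(t_0)| exp((G(x) - G(t_0)) / (1 - nu^+)),
      |u(t_0)| <= |u(t_n)| exp((G(t_n) - G(t_0)) / (1 - nu^-)),
    the second estimate by running the steps backwards.  As G is bounded on
    [t_0, oo), all solutions are bounded, and the homeomorphism is the map
    u(t_0) |-> u.  Increments of u are at most a constant times those of G, whence
    convergence.  The limit depends linearly on u(t_0), injectively by the backward
    estimate, hence bijectively since the dimension is finite. *)

Require Import Defs.
From mathcomp Require Import all_boot all_order all_algebra.
From mathcomp Require Import complex lra ring.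
From mathcomp Require Import all_classical all_reals all_analysis.
From mathcomp Require Import measurable_realfun.

Set Implicit Arguments.
Unset Strict Implicit.
Unset Printing Implicit Defensive.

Import Order.TTheory GRing.Theory Num.Theory.
Import numFieldNormedType.Exports.

Local Open Scope classical_set_scope.
Local Open Scope ring_scope.
Local Open Scope complex_scope.

(** * Norms on a finite-dimensional complex space *)

Section Norm.
Context {R : realType} {p : nat} {N : 'cV[R[i]]_p -> R} (hN : is_norm N).
Implicit Types (x y : 'cV[R[i]]_p).

Lemma is_norm_triangle x y : N (x + y) <= N x + N y.
Proof. by case: hN. Qed.

Lemma is_normZ (a : R[i]) x : N (a *: x) = Normc.normc a * N x.
Proof. by case: hN. Qed.

Lemma is_norm0_eq0 x : N x = 0 -> x = 0.
Proof. by case: hN => _ _; exact. Qed.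

Lemma is_norm0 : N 0 = 0.
Proof. by rewrite -(scale0r 0) is_normZ Normc.normc0 mul0r. Qed.

Lemma is_normN x : N (- x) = N x.
Proof. by rewrite -scaleN1r is_normZ normcN Normc.normc1 mul1r. Qed.

Lemma is_norm_ge0 x : 0 <= N x.
Proof.
have := is_norm_triangle x (- x).
rewrite is_normN subrr is_norm0 => h; lra.
Qed.

Lemma is_normC x y : N (x - y) = N (y - x).
Proof. by rewrite -is_normN opprB. Qed.

Lemma is_norm_triangleB z x y : N (x - y) <= N (x - z) + N (z - y).
Proof. by apply: le_trans (is_norm_triangle _ _); rewrite addrA subrK. Qed.

Lemma is_norm_subr_le x y : N x <= N y + N (x - y).
Proof. by rewrite -{1}(subrKC y x); apply: is_norm_triangle. Qed.

Lemma is_norm_sub_abs x y : `|N x - N y| <= N (x - y).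
Proof.
have := is_norm_subr_le x y; have := is_norm_subr_le y x.
by rewrite (is_normC y x) => h1 h2; rewrite ler_norml; apply/andP; split; lra.
Qed.

Lemma is_norm_sum I (r : seq I) (P : pred I) (F : I -> 'cV[R[i]]_p) :
  N (\sum_(i <- r | P i) F i) <= \sum_(i <- r | P i) N (F i).
Proof.
elim/big_ind2 : _ => //; first by rewrite is_norm0.
by move=> x1 x2 y1 y2 h1 h2; apply: le_trans (is_norm_triangle _ _) (lerD _ _).
Qed.

(** The reference norm: the sum of the absolute values of the [p + p] real coordinates. Comparing
    [N] with it turns limits and estimates into real scalar ones. *)
Definition l1norm x : R := \sum_j (`|complex.Re (x j 0)| + `|complex.Im (x j 0)|).

Lemma normc_le_ReIm (z : R[i]) :
  Normc.normc z <= `|complex.Re z| + `|complex.Im z|.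
Proof.
case: z => a b /=; rewrite -[leRHS]ger0_norm ?addr_ge0 // -sqrtr_sqr.
apply: ler_wsqrtr; rewrite sqrrD !real_normK ?num_real //.
by rewrite lerD2r lerDl mulrn_wge0 // mulr_ge0.
Qed.

(** Expand [x] in the standard basis; the sum of all [N (delta_mx j 0)] dominates each of them and
    serves as a common constant. *)
Lemma is_norm_le_l1 : exists2 C, 0 <= C & forall x, N x <= C * l1norm x.
Proof.
exists (\sum_j N (delta_mx j 0)).
  by apply: sumr_ge0 => j _; apply: is_norm_ge0.
move=> x; rewrite {1}(matrix_sum_delta x).
apply: le_trans (is_norm_sum _ _ _) _; rewrite mulr_sumr.
apply: ler_sum => j _; rewrite big_ord1 is_normZ mulrC.
apply: ler_pM => //; first exact: is_norm_ge0.
- by case: (x j 0) => a b; apply: sqrtr_ge0.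
- by rewrite (bigD1 j) //= lerDl sumr_ge0 // => k _; apply: is_norm_ge0.
- exact: normc_le_ReIm.
Qed.

(** Real coordinates on [C^p], real parts first, so that compactness of bounded closed sets of real
    row vectors applies. *)
Let toC (v : 'rV[R]_(p + p)) : 'cV[R[i]]_p :=
  \col_j (v 0 (lshift p j) +i* v 0 (rshift p j)).

Let l1norm_toC v : l1norm (toC v) <= (p%:R + p%:R) * `|v|.
Proof.
have ev j : `|v 0 j| <= `|v|.
  rewrite [leRHS]/Num.norm /= mx_normrE.
  by apply: (le_bigmax _ (fun ij : 'I_1 * 'I_(p + p) => `|v ij.1 ij.2|) (0, j)).
rewrite /l1norm (eq_bigr (fun j => `|v 0 (lshift p j)| + `|v 0 (rshift p j)|)).
  rewrite -[p in p%:R]card_ord -natrD mulr_natl.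
  rewrite mulrnDr -sumr_const -big_split /=.
  by apply: ler_sum => j _; apply: lerD.
by move=> j _; rewrite mxE.
Qed.

(* [N] attains a positive minimum on the unit sphere of [R^(p + p)]. *)
Lemma l1_le_is_norm : exists2 C, 0 <= C & forall x, l1norm x <= C * N x.
Proof.
have [C C0 hC] := is_norm_le_l1.
have toCZ (a : R) v : toC (a *: v) = a%:C *: toC v.
  by apply/colP => j; rewrite !mxE; simpc.
have toCB v w : toC (v - w) = toC v - toC w.
  by apply/colP => j; rewrite !mxE; simpc.
(* This map is Lipschitz with constant [C * (p + p)]; the added 1 keeps the divisor positive. *)
have cont : continuous (fun v => N (toC v)).
  move=> v; apply/(@cvgrPdist_le _ _ _ _ (nbhs_filter v)) => e e0.
  have k0 : 0 < C * (p%:R + p%:R) + 1.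
    by rewrite ltr_pwDr // mulr_ge0 // addr_ge0.
  have hn : \forall w \near v, `|v - w| <= e / (C * (p%:R + p%:R) + 1).
    apply/(@nbhs_normP R _ v); exists (e / (C * (p%:R + p%:R) + 1)).
      by rewrite /= divr_gt0.
    by move=> w /ltW.
  apply: (@filterS _ (nbhs v) _ _ _ _ hn) => w; rewrite ler_pdivlMr // => hw.
  apply: le_trans (is_norm_sub_abs _ _) _.
  rewrite -toCB; apply: le_trans (hC _) _.
  apply: le_trans (ler_wpM2l C0 (l1norm_toC _)) _.
  apply: le_trans (_ : (C * (p%:R + p%:R) + 1) * `|v - w| <= _).
    by rewrite mulrA ler_wpM2r // lerDl.
  by rewrite mulrC.
pose S := [set v : 'rV[R]_(p + p) | `|v| = 1].
have cS : compact S.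
  apply: bounded_closed_compact.
    by exists 1; split; rewrite ?num_real // => M M1 v /= ->; apply: ltW.
  rewrite (_ : S = (fun v => `|v|) @^-1` [set 1]) //.
  by apply: closed_comp => [v _|]; [exact: norm_continuous|exact: closed_eq].
have toCK x : exists v, x = toC v.
  exists (row_mx (\row_j complex.Re (x j 0)) (\row_j complex.Im (x j 0))).
  apply/colP => j; rewrite [RHS]mxE row_mxEl row_mxEr !mxE.
  by case: (x j 0).
(* If the sphere is empty there is no minimum, but then every vector is 0. *)
have [S0|S0] := pselect (S !=set0); last first.
  exists 0 => // x; have [v ->] := toCK x.
  rewrite mul0r (_ : v = 0); last first.
    apply/eqP/negP => /negP v0; apply: S0; exists (`|v|^-1 *: v).
    by rewrite /S /= normrZ normrV ?unitfE ?normr_eq0 // normr_id mulVf ?normr_eq0.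
  by apply: le_trans (l1norm_toC _) _; rewrite normr0 mulr0.
have [c cS1 cmin] := EVT_min_rV S0 cS (continuous_subspaceT cont).
have c0 : 0 < N (toC c).
  rewrite lt_neqAle is_norm_ge0 andbT eq_sym; apply/eqP => /is_norm0_eq0 tc.
  have : c = 0.
    apply/rowP => j; rewrite mxE -(splitK j).
    case: (fintype.split j) => k /=; move/colP/(_ k): tc; rewrite !mxE;
      by case.
  by move/set_mem: cS1; rewrite /S /= => + c0; rewrite c0 normr0 => /eqP; rewrite eq_sym oner_eq0.
exists ((p%:R + p%:R) / N (toC c)).
  by rewrite divr_ge0 // ?addr_ge0 // ltW.
move=> x; have [v ->] := toCK x.
apply: le_trans (l1norm_toC _) _; rewrite -mulrA.
apply: ler_wpM2l; first by rewrite addr_ge0.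
rewrite mulrC ler_pdivlMr //.
have [->|v0] := eqVneq v 0; first by rewrite normr0 mul0r is_norm_ge0.
(* By homogeneity, minimality of [c] is applied to [v] scaled to the unit sphere. *)
have nv0 : 0 < `|v| by rewrite normr_gt0.
have /cmin : `|v|^-1 *: v \in S.
  by apply/mem_set; rewrite /S /= normrZ normrV ?unitfE ?gt_eqF // normr_id mulVf ?gt_eqF.
rewrite toCZ is_normZ /= expr0n /= addr0 sqrtr_sqr ger0_norm ?invr_ge0 //.
by rewrite mulrC ler_pdivlMr // mulrC.
Qed.

End Norm.

(** * Induced norm and mean value inequality *)

Section InducedNorm.
Context {R : realType} {p : nat} {N : 'cV[R[i]]_p -> R} (hN : is_norm N).
Implicit Types (x y : 'cV[R[i]]_p) (M : 'M[R[i]]_p).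

Lemma normc_ge0 (z : R[i]) : 0 <= Normc.normc z.
Proof. by case: z => a b; apply: sqrtr_ge0. Qed.

(** [M *m x] is a combination of the columns of [M]. The induced norm does not occur here, so this
    bound can be used to show that its supremum is finite. *)
Lemma norm_mulmx_le M x : N (M *m x) <= \sum_k Normc.normc (x k 0) * N (col k M).
Proof.
rewrite (_ : M *m x = \sum_k x k 0 *: col k M).
  apply: le_trans (is_norm_sum hN _ _ _) _.
  by apply: ler_sum => k _; rewrite (is_normZ hN).
apply/colP => j; rewrite summxE mxE.
by apply: eq_bigr => k _; rewrite !mxE mulrC.
Qed.

(* Without this bound, which rests on the equivalence of norms, the supremum
   defining [induced_norm] would be the junk value 0. *)
Lemma induced_norm_has_ubound M :
  has_ubound [set N (M *m x) | x in [set x | N x <= 1]].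
Proof.
have [C C0 hC] := l1_le_is_norm hN.
exists (\sum_k C * N (col k M)) => _ [x /= Nx1 <-].
apply: le_trans (norm_mulmx_le M x) _.
apply: ler_sum => k _; apply: ler_wpM2r; first exact: is_norm_ge0.
apply: le_trans (normc_le_ReIm _) _.
apply: le_trans (_ : l1norm x <= _).
  by rewrite /l1norm (bigD1 k) //= lerDl sumr_ge0 // => j _; rewrite addr_ge0.
by apply: le_trans (hC x) _; rewrite -[leRHS]mulr1 ler_wpM2l.
Qed.

Lemma induced_norm_ge0 M : 0 <= induced_norm N M.
Proof.
apply: ub_le_sup; first exact: induced_norm_has_ubound.
by exists 0; rewrite /= ?mulmx0 ?(is_norm0 hN).
Qed.

Lemma le_induced_norm M x : N (M *m x) <= induced_norm N M * N x.
Proof.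
have [Nx0|Nx0] := eqVneq (N x) 0.
  by rewrite Nx0 (is_norm0_eq0 hN Nx0) mulmx0 is_norm0 // mulr0.
have Nxp : 0 < N x by rewrite lt_neqAle eq_sym Nx0 is_norm_ge0.
have nV : Normc.normc ((N x)^-1)%:C = (N x)^-1.
  by rewrite /= expr0n /= addr0 sqrtr_sqr ger0_norm ?invr_ge0 ?is_norm_ge0.
rewrite -ler_pdivrMr // mulrC -nV -is_normZ // scalemxAr.
apply: ub_le_sup; first exact: induced_norm_has_ubound.
by exists ((N x)^-1%:C *: x) => //=; rewrite is_normZ // nV mulVf.
Qed.

Lemma induced_norm_triangle M M' :
  induced_norm N (M + M') <= induced_norm N M + induced_norm N M'.
Proof.
apply: ge_sup => [|_ [x /= Nx1 <-]].
  by exists (N ((M + M') *m 0)), 0; rewrite /= ?is_norm0.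
rewrite mulmxDl; apply: le_trans (is_norm_triangle hN _ _) _.
by apply: lerD; (apply: le_trans (le_induced_norm _ _) _;
  rewrite -[leRHS]mulr1 ler_wpM2l // induced_norm_ge0).
Qed.

Lemma induced_normN M : induced_norm N (- M) = induced_norm N M.
Proof.
congr sup; apply/seteqP; split => [_ [x /= Nx <-]|_ [x /= Nx <-]].
  by exists x; rewrite // mulNmx is_normN.
by exists x; rewrite // mulNmx is_normN.
Qed.

Lemma induced_norm_sub_abs M M' :
  `|induced_norm N M - induced_norm N M'| <= induced_norm N (M - M').
Proof.
have h1 := induced_norm_triangle (M - M') M'.
have h2 := induced_norm_triangle (M' - M) M.
rewrite subrK in h1; rewrite subrK -opprB induced_normN in h2.
by rewrite ler_norml; apply/andP; split; lra.
Qed.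

(** An entry is a coordinate of the column [M *m delta_mx k 0]. This bound passes continuity of [B]
    in the induced norm on to its real entries. *)
Lemma entry_le_induced_norm : exists2 C, 0 <= C & forall M j k,
  `|complex.Re (M j k)| <= C * induced_norm N M /\
  `|complex.Im (M j k)| <= C * induced_norm N M.
Proof.
have [C C0 hC] := l1_le_is_norm hN.
have S0 : 0 <= \sum_k N (delta_mx k 0).
  by apply: sumr_ge0 => k _; apply: is_norm_ge0.
exists (C * \sum_k N (delta_mx k 0)); first exact: mulr_ge0.
move=> M j k.
suff h : `|complex.Re (M j k)| + `|complex.Im (M j k)| <=
    C * (\sum_k N (delta_mx k 0)) * induced_norm N M.
  by split; apply: le_trans h; rewrite ?lerDl ?lerDr.
apply: le_trans (_ : l1norm (M *m delta_mx k 0) <= _).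
  rewrite -colE /l1norm (bigD1 j) //= mxE lerDl.
  by apply: sumr_ge0 => i _; apply: addr_ge0.
apply: le_trans (hC _) _; rewrite -mulrA; apply: ler_wpM2l => //.
apply: le_trans (le_induced_norm _ _) _; rewrite mulrC.
apply: ler_wpM2r; first exact: induced_norm_ge0.
by rewrite (bigD1 k) //= lerDl sumr_ge0 // => i _; apply: is_norm_ge0.
Qed.

End InducedNorm.

(** * Interval induction and a mean value inequality *)

Section MeanValue.
Context {R : realType}.

(* Cousin's lemma, by taking the supremum of the [s] with [P a s]. *)
Lemma additive_itv_ind (P : R -> R -> Prop) (a b : R) : a <= b ->
  (forall x y z, a <= x -> x <= y -> y <= z -> z <= b ->
    P x y -> P y z -> P x z) ->
  (forall x, a <= x <= b -> \forall y \near x, a <= y <= b ->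
    (x <= y -> P x y) /\ (y <= x -> P y x)) ->
  P a b.
Proof.
move=> ab Padd Ploc.
pose S := [set s | a <= s <= b /\ P a s].
have Sa : S a.
  have aab : a <= a <= b by rewrite lexx.
  by split=> //; have /nbhs_singleton/(_ aab)[h _] := Ploc a aab; apply: h.
have Sb : has_ubound S by exists b => s [/andP[]].
have hS : has_sup S by split => //; exists a.
have as_ : a <= sup S by apply: ub_le_sup.
have sb : sup S <= b by apply: ge_sup; [exists a|move=> s [/andP[]]].
(* The local hypothesis at the supremum links it to some point of [S] at distance less than [d], so
   [S] contains its supremum. *)
have /nbhs_ballP[d /= d0 hd] := Ploc (sup S) (introT andP (conj as_ sb)).
have [s Ss sd] := sup_adherent d0 hS.
have ss : s <= sup S by apply: ub_le_sup.
have Psup : P a (sup S).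
  case: Ss => /andP[as1 sb1] Pas.
  apply: (Padd a s) => //.
  have /hd : ball (sup S) d s by rewrite /ball /= ger0_norm; lra.
  by rewrite as1 sb1 => /(_ isT)[_]; apply.
have [/eqP|sb'] := eqVneq (sup S) b; first by move/eqP <-.
(* If the supremum were below [b], the same local hypothesis would reach this larger point of
   [S]. *)
pose y := Num.min b (sup S + d / 2).
have yb : y <= b by rewrite ge_min lexx.
have sy : sup S < y by rewrite lt_min lt_neqAle sb' sb ltrDl divr_gt0.
have Sy : S y.
  have ay : a <= y <= b by rewrite yb andbT; lra.
  split => //; apply: (Padd a (sup S) y) => //; first exact: ltW.
  have yd : y <= sup S + d / 2 by rewrite ge_min lexx orbT.
  have /hd : ball (sup S) d y.
    by rewrite /ball /= ltr0_norm; lra.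
  by rewrite ay => /(_ isT)[+ _]; apply; exact: ltW.
by have := ub_le_sup Sb Sy; rewrite leNgt sy.
Qed.

Context {p : nat} {N : 'cV[R[i]]_p -> R} (hN : is_norm N).

(** The local estimates, with slack [e] per unit length, are additive, so [additive_itv_ind] sums
    them to [G b - G a + e * (b - a)]; then [e] tends to 0. *)
Lemma norm_increment_le (F : R -> 'cV[R[i]]_p) (G : R -> R) (a b : R) : a <= b ->
  (forall x, a <= x <= b -> forall e, 0 < e -> \forall y \near x, a <= y <= b ->
     N (F y - F x) <= `|G y - G x| + e * `|y - x|) ->
  {in `[a, b] &, {homo G : x y / x <= y}} ->
  N (F b - F a) <= G b - G a.
Proof.
move=> ab hF hG.
have key e : 0 < e -> N (F b - F a) <= G b - G a + e * (b - a).
  move=> e0.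
  apply: (@additive_itv_ind
    (fun x y => N (F y - F x) <= G y - G x + e * (y - x))) => // [x y z _ _ _ _ h1 h2|x hx].
    by have := is_norm_triangleB hN (F y) (F z) (F x); lra.
  apply: filterS (hF x hx e e0) => y hy ay; have h := hy ay; split=> xy.
    have := hG x y; rewrite !in_itv /= => /(_ hx ay xy) g.
    by move: h; rewrite !ger0_norm ?subr_ge0.
  have := hG y x; rewrite !in_itv /= => /(_ ay hx xy) g.
  move: h; rewrite (is_normC hN) !ler0_norm ?subr_le0 //.
  by rewrite !opprB.
apply/ler_addgt0Pr => e e0.
have b1 : 0 < b - a + 1 by lra.
apply: le_trans (key (e / (b - a + 1)) _) _; first by rewrite divr_gt0.
rewrite lerD2l mulrAC ler_pdivrMr // ler_pM2l //; lra.
Qed.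

Lemma norm_scale_real (r : R) (x : 'cV[R[i]]_p) : N (r%:C *: x) = `|r| * N x.
Proof. by rewrite is_normZ //= expr0n /= addr0 sqrtr_sqr. Qed.

(** First-order form of the difference quotient, obtained by multiplying by [|y - x|]. The set [D]
    lets one statement cover two-sided and one-sided derivatives. *)
Lemma diff_quot_cvgP (D : set R) (x : R) (F : R -> 'cV[R[i]]_p) l :
  (forall y, D y -> y != x) ->
  norm_cvg N (within D (nbhs x)) (diff_quot F x) l <->
  (forall e, 0 < e -> \forall y \near x, D y ->
     N (F y - F x - (y - x)%:C *: l) <= e * `|y - x|).
Proof.
move=> Dx.
have E y : D y -> N (F y - F x - (y - x)%:C *: l) = `|y - x| * N (diff_quot F x y - l).
  move=> /Dx yx; rewrite -norm_scale_real /diff_quot scalerBr scalerA.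
  by rewrite -rmorphM mulfV ?subr_eq0 // scale1r.
split=> [h e e0|h].
  have /cvgrPdist_le/(_ e e0) := h.
  rewrite near_withinE; apply: filterS => y hy Dy.
  rewrite E // mulrC ler_wpM2r //; move: (hy Dy).
  by rewrite sub0r normrN ger0_norm // is_norm_ge0.
apply/cvgrPdist_le => e e0.
rewrite near_withinE; apply: filterS (h e e0) => y hy Dy.
move: (hy Dy); rewrite E // mulrC ler_pM2r ?normr_gt0 ?subr_eq0 ?Dx //.
by rewrite sub0r normrN ger0_norm // is_norm_ge0.
Qed.

End MeanValue.

(** * Primitives *)

Section Primitive.
Context {R : realType}.
Local Notation mu := (@lebesgue_measure R).

Definition primitive (a : R) (f : R -> R) (x : R) : R := \int[mu]_(s in `[a, x]) f s.

Context (a : R) (f : R -> R) (cf : continuous f).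

Let f_integrable x y : mu.-integrable `[x, y] (EFin \o f).
Proof.
by apply: continuous_compact_integrable;
  [exact: segment_compact|exact: continuous_subspaceT].
Qed.

(** The fundamental theorem of calculus on [[a, x + 1]], where [x] is interior, rewritten as a
    first-order estimate. *)
Lemma primitive_deriv x : a < x -> forall e, 0 < e ->
  \forall y \near x, `|primitive a f y - primitive a f x - (y - x) * f x| <= e * `|y - x|.
Proof.
move=> ax e e0.
have [d dE] := continuous_FTC1_closed (ltr_pwDr ltr01 (lexx x))
  (f_integrable a (x + 1)) ax (@cf x).
have lim : h^-1 *: (((primitive a f) \o shift x) (h *: (1 : R)) - primitive a f x)
    @[h --> 0^'] --> f x by rewrite -dE derive1E; exact: d.
have /cvgrPdist_le/(_ e e0)/nbhs_ballP[r /= r0 hr] := lim.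
apply/nbhs_ballP; exists r => //= y xy.
have [->|yx] := eqVneq y x; first by rewrite !subrr mul0r subrr !normr0 mulr0.
have yx0 : y - x != 0 by rewrite subr_eq0.
have /hr : ball 0 r (y - x) by rewrite /ball /= sub0r normrN distrC.
move=> /(_ yx0); rewrite /= [_ *: 1]mulr1 subrK.
rewrite -(@ler_pM2r _ `|y - x|) ?normr_gt0 //.
rewrite -normrM mulrBl [_ *: _]mulrC mulfVK // distrC.
by rewrite [f x * _]mulrC.
Qed.

Lemma primitive_continuous x : a < x -> {for x, continuous (primitive a f)}.
Proof.
move=> ax.
have [+ _] := continuous_FTC1_closed (ltr_pwDr ltr01 (lexx x))
  (f_integrable a (x + 1)) ax (@cf x).
by move=> /derivable1_diffP/differentiable_continuous.
Qed.

(** Since endpoints are null sets, the open interval serves for comparison with integrals over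
    closed intervals too. *)
Lemma primitiveB x y : a <= x -> x <= y ->
  ((primitive a f y - primitive a f x)%:E = \int[mu]_(s in `]x, y[) (f s)%:E)%E.
Proof.
move=> ax xy; have mf : measurable_fun setT f by exact: continuous_measurable_fun.
rewrite /primitive Rintegral_itvB ?bnd_simp //.
rewrite /Rintegral fineK.
  apply: integral_itv_bndoo.
  by apply: measurable_funTS; apply/measurable_EFinP.
apply: integrable_fin_num => //.
apply: integrableS (f_integrable a y) => //.
by apply: subset_itv; rewrite bnd_simp.
Qed.

Lemma primitive_nondecreasing x y : (forall s, 0 <= f s) -> a <= x -> x <= y ->
  primitive a f x <= primitive a f y.
Proof.
move=> f0 ax xy; rewrite -subr_ge0 -lee_fin primitiveB //.
by apply: integral_ge0 => s _; rewrite lee_fin.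
Qed.

End Primitive.

(** * Entrywise primitives of a matrix-valued function *)

Section MatrixPrimitive.
Context {R : realType} {p : nat} {N : 'cV[R[i]]_p -> R} (hN : is_norm N).
Context (a : R) (B : R -> 'M[R[i]]_p).
Context (hB : forall x : R, norm_cvg (induced_norm N) (nbhs x) B (B x)).

Lemma continuous_of_induced_norm (f : R -> R) (C : R) : 0 <= C ->
  (forall x y, `|f y - f x| <= C * induced_norm N (B y - B x)) -> continuous f.
Proof.
move=> C0 hf x; apply/cvgrPdist_le => e e0.
have c1 : 0 < C + 1 by lra.
have /cvgrPdist_le/(_ (e / (C + 1))) := hB x.
rewrite divr_gt0 // => /(_ isT); apply: filterS => y.
rewrite sub0r normrN ger0_norm ?induced_norm_ge0 // ler_pdivlMr // mulrC => h.
rewrite distrC; apply: le_trans (hf x y) _; apply: le_trans h.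
by apply: ler_wpM2r; [exact: induced_norm_ge0|rewrite lerDl].
Qed.

Lemma continuous_induced_norm : continuous (fun s => induced_norm N (B s)).
Proof.
apply: (@continuous_of_induced_norm _ 1) => // x y.
by rewrite mul1r; apply: induced_norm_sub_abs.
Qed.

Lemma continuous_Re_entry j k : continuous (fun s => complex.Re (B s j k)).
Proof.
have [C C0 hC] := entry_le_induced_norm hN.
apply: (continuous_of_induced_norm C0) => x y.
have [+ _] := hC (B y - B x) j k.
by rewrite !mxE; case: (B y j k) (B x j k) => ? ? [].
Qed.

Lemma continuous_Im_entry j k : continuous (fun s => complex.Im (B s j k)).
Proof.
have [C C0 hC] := entry_le_induced_norm hN.
apply: (continuous_of_induced_norm C0) => x y.
have [_ +] := hC (B y - B x) j k.
by rewrite !mxE; case: (B y j k) (B x j k) => ? ? [].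
Qed.

(** The integral of [B] from [a], taken separately on real and imaginary parts so that only real
    integrals occur. *)
Definition mx_primitive (x : R) : 'M[R[i]]_p :=
  \matrix_(j, k) (primitive a (fun s => complex.Re (B s j k)) x +i*
                  primitive a (fun s => complex.Im (B s j k)) x).

Local Notation A := mx_primitive.
Local Notation G := (primitive a (fun s => induced_norm N (B s))).

Lemma mx_primitive_deriv (v : 'cV[R[i]]_p) x : a < x -> forall e, 0 < e ->
  \forall y \near x,
    N (A y *m v - A x *m v - (y - x)%:C *: (B x *m v)) <= e * `|y - x|.
Proof.
move=> ax e e0; have [C C0 hC] := is_norm_le_l1 hN.
(* [K - 1] is the factor lost: [C * (p * 2)] from real entries to [N] of a column, then the weights
   of the columns in [M *m v]. The 1 makes [K] positive. *)
pose K := (\sum_k Normc.normc (v k 0)) * (C * (p%:R * 2)) + 1.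
have S0 : 0 <= \sum_k Normc.normc (v k 0).
  by apply: sumr_ge0 => k _; apply: normc_ge0.
have K0 : 0 < K by rewrite ltr_pwDr // !mulr_ge0.
have d0 : 0 < e / K by rewrite divr_gt0.
have hre (jk : 'I_p * 'I_p) : \forall y \near x,
    `|primitive a (fun s => complex.Re (B s jk.1 jk.2)) y -
      primitive a (fun s => complex.Re (B s jk.1 jk.2)) x -
      (y - x) * complex.Re (B x jk.1 jk.2)| <= e / K * `|y - x|.
  exact: (primitive_deriv (@continuous_Re_entry jk.1 jk.2)).
have him (jk : 'I_p * 'I_p) : \forall y \near x,
    `|primitive a (fun s => complex.Im (B s jk.1 jk.2)) y -
      primitive a (fun s => complex.Im (B s jk.1 jk.2)) x -
      (y - x) * complex.Im (B x jk.1 jk.2)| <= e / K * `|y - x|.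
  exact: (primitive_deriv (@continuous_Im_entry jk.1 jk.2)).
apply: filterS2 (filter_forall _ hre) (filter_forall _ him) => y {}hre {}him.
rewrite scalemxAl -!mulmxBl; apply: le_trans (norm_mulmx_le hN _ _) _.
have hcol k : N (col k (A y - A x - (y - x)%:C *: B x)) <=
    C * (p%:R * 2) * (e / K * `|y - x|).
  apply: le_trans (hC _) _; rewrite -!mulrA ler_wpM2l // -[p in p%:R]card_ord.
  rewrite mulr_natl -sumr_const ler_sum // => j _.
  have := hre (j, k); have := him (j, k); rewrite !mxE /=.
  by case: (B x j k) => br bi /=; rewrite !mul0r subr0 addr0 => h1 h2; lra.
apply: le_trans (_ : \sum_k Normc.normc (v k 0) * (C * (p%:R * 2) * (e / K * `|y - x|)) <= _).
  by apply: ler_sum => k _; rewrite ler_wpM2l ?normc_ge0.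
rewrite -mulr_suml.
rewrite (_ : _ * _ = (K - 1) / K * (e * `|y - x|)); last first.
  by rewrite addrK mulrA [e / K]mulrC -!mulrA.
rewrite -[leRHS]mul1r; apply: ler_wpM2r; first by rewrite mulr_ge0 // ltW.
by rewrite ler_pdivrMr // mul1r gerBl.
Qed.

Lemma mx_primitive_continuous (v : 'cV[R[i]]_p) x : a < x -> forall e, 0 < e ->
  \forall y \near x, N (A y *m v - A x *m v) <= e.
Proof.
move=> ax e e0; have v0 := is_norm_ge0 hN (B x *m v).
have k0 : 0 < N (B x *m v) + 1 by lra.
have hd : \forall y \near x, `|x - y| <= e / (N (B x *m v) + 1).
  apply/nbhs_ballP; exists (e / (N (B x *m v) + 1)); first by rewrite /= divr_gt0.
  by move=> y /ltW.
apply: filterS2 hd (mx_primitive_deriv v ax ltr01) => y.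
rewrite ler_pdivlMr // distrC mul1r => h1 h2.
have := is_norm_subr_le hN (A y *m v - A x *m v) ((y - x)%:C *: (B x *m v)).
by rewrite (norm_scale_real hN); lra.
Qed.

(** The norm of an integral is at most the integral of the norm; it follows from the mean value
    inequality by comparing the derivatives [B s *m v] and [|B s| * N v]. *)
Lemma mx_primitive_increment (v : 'cV[R[i]]_p) x y : a < x -> x <= y ->
  N (A y *m v - A x *m v) <= (G y - G x) * N v.
Proof.
move=> ax xy; rewrite mulrBl.
have NG s e : a < s -> 0 < e -> \forall r \near s,
    `|G r - G s - (r - s) * induced_norm N (B s)| <= e * `|r - s|.
  by move=> as_; apply: (primitive_deriv continuous_induced_norm).
apply: (norm_increment_le hN (F := fun s => A s *m v) (G := fun s => G s * N v)) => //.
  move=> s /andP[xs _] e e0; have as_ : a < s by apply: lt_le_trans xs.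
  have v0 := is_norm_ge0 hN v.
  (* Half of [e] goes to each side; the error of [G] is later multiplied by [N v], hence the
     divisor. *)
  have e1 : 0 < e / 2 / (N v + 1) by rewrite !divr_gt0 // ltr_pwDr.
  have e2 : 0 < e / 2 by rewrite divr_gt0.
  apply: filterS2 (mx_primitive_deriv v as_ e2) (NG s _ as_ e1) => r h1 h2 _.
  have h3 := is_norm_subr_le hN (A r *m v - A s *m v) ((r - s)%:C *: (B s *m v)).
  have h4 : N ((r - s)%:C *: (B s *m v)) <= `|(r - s) * induced_norm N (B s)| * N v.
    rewrite (norm_scale_real hN) normrM (ger0_norm (induced_norm_ge0 hN _)) -mulrA.
    by rewrite ler_wpM2l // le_induced_norm.
  have h5 : `|(r - s) * induced_norm N (B s)| <=
      `|G r - G s| + e / 2 / (N v + 1) * `|r - s|.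
    rewrite -[X in `|X| <= _](subKr (G r - G s)).
    by apply: le_trans (ler_normB _ _) _; rewrite lerD2l.
  have h6 : `|(r - s) * induced_norm N (B s)| * N v <=
      `|G r * N v - G s * N v| + e / 2 * `|r - s|.
    rewrite -mulrBl [X in _ <= X + _]normrM (ger0_norm v0).
    apply: le_trans (ler_wpM2r v0 h5) _; rewrite mulrDl lerD2l.
    rewrite [leLHS](_ : _ = e / 2 * `|r - s| * (N v / (N v + 1))); last by ring.
    apply: ler_piMr; first by rewrite mulr_ge0 // ltW.
    by rewrite ler_pdivrMr ?ltr_pwDr // mul1r lerDl.
  lra.
move=> s r; rewrite !in_itv /= => /andP[xs _] _ sr.
apply: ler_wpM2r; first exact: is_norm_ge0.
apply: (primitive_nondecreasing continuous_induced_norm) => //.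
  by move=> ?; apply: induced_norm_ge0.
by apply: le_trans xs; apply: ltW.
Qed.


End MatrixPrimitive.

(** * Piecewise integrated solutions *)

(** [kermx] consists of row vectors, hence the passage to the transpose. *)
Lemma unitmx_of_injective (F : fieldType) (n : nat) (M : 'M[F]_n) :
  (forall x : 'cV_n, M *m x = 0 -> x = 0) -> M \in unitmx.
Proof.
move=> inj; rewrite -unitmx_tr -row_free_unit -kermx_eq0.
apply/eqP/row_matrixP => i; rewrite row0; apply: trmx_inj; rewrite trmx0.
apply: inj; apply: trmx_inj; rewrite trmx_mul trmxK trmx0.
by rewrite -row_mul mulmx_ker row0.
Qed.

(** Both [H] and [f + H] are nondecreasing and bounded, so they converge, and [f] is their
    difference. *)
Lemma cvgy_of_increments_le (R : realType) (a K : R) (f H : R -> R) :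
  (forall x y, a <= x -> x <= y -> `|f y - f x| <= H y - H x) ->
  (forall x, a <= x -> H x - H a <= K) ->
  exists l : R, f x @[x --> +oo] --> l.
Proof.
move=> hf hH.
(* Truncating the argument at [a] turns monotonicity on [[a, +oo[] into monotonicity on the whole
   line. *)
have am x : a <= Num.max a x by rewrite le_max lexx.
have mm x y : x <= y -> Num.max a x <= Num.max a y.
  by move=> xy; rewrite ge_max !le_max lexx xy orbT.
have H_cvg : cvg (H (Num.max a x) @[x --> +oo]).
  apply: cvgP; apply: nondecreasing_cvgr.
    move=> x y xy; have := hf _ _ (am x) (mm _ _ xy).
    by move/(le_trans (normr_ge0 _)); rewrite subr_ge0.
  by exists (H a + K) => _ [x _ <-]; have := hH _ (am x); lra.
have fH_cvg : cvg ((f (Num.max a x) + H (Num.max a x)) @[x --> +oo]).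
  apply: cvgP; apply: (@nondecreasing_cvgr _ (fun x => f (Num.max a x) + H (Num.max a x))).
    move=> x y xy; have := hf _ _ (am x) (mm _ _ xy).
    by rewrite ler_norml => /andP[]; lra.
  exists (f a + H a + 2 * K) => _ [x _ <-]; have := hH _ (am x).
  by have := hf _ _ (lexx a) (am x); rewrite ler_norml => /andP[]; lra.
have /cvg_ex[h hh] := H_cvg; have /cvg_ex[k hk] := fH_cvg.
exists (k - h).
apply: cvg_trans (cvgB hk hh); apply: near_eq_cvg.
near=> x; rewrite /= addrK max_r //.
Unshelve. all: by end_near. Qed.

Section PiecewiseSolutions.
Context {R : realType} {p : nat} {N : 'cV[R[i]]_p -> R} (hN : is_norm N).
Context (tau zeta : nat -> R).
Context (tauS : forall n, tau n < tau n.+1).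
Context (tau_zeta : forall n, tau n <= zeta n <= tau n.+1).
Context (tau_unbounded : forall x, exists n, x < tau n).
Context (A : R -> 'M[R[i]]_p) (G : R -> R) (nup num K : R).
Context (nup1 : nup < 1) (num1 : num < 1).
Context (hA : forall v x y, tau 0 <= x -> x <= y ->
  N (A y *m v - A x *m v) <= (G y - G x) * N v).
Context (hG : forall x y, tau 0 <= x -> x <= y -> G x <= G y).
Context (hGp : forall n, G (zeta n) - G (tau n) <= nup).
Context (hGm : forall n, G (tau n.+1) - G (zeta n) <= num).
Context (hGK : forall x, tau 0 <= x -> G x - G (tau 0) <= K).

(** The equation in integrated form. The pieces are closed, so two formulas hold at each [tau n.+1];
    this encodes continuity there. *)
Definition piecewise_sol (u : R -> 'cV[R[i]]_p) : Prop :=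
  (forall x, x < tau 0 -> u x = 0) /\
  (forall n x, tau n <= x <= tau n.+1 ->
     u x = u (zeta n) + (A x *m u (zeta n) - A (zeta n) *m u (zeta n))).

Lemma tau_mono : {homo tau : m n / (m <= n)%N >-> m <= n}.
Proof. by apply: homo_leq => [//|? ? ?|n]; [exact: le_trans|exact: ltW]. Qed.

Lemma tau0_le n : tau 0 <= tau n.
Proof. exact: tau_mono. Qed.

Lemma tau_cover x : tau 0 <= x -> exists n, tau n <= x < tau n.+1.
Proof.
move=> x0; case: (ex_minnP (tau_unbounded x)) => -[|n] xn hn.
  by move: xn; rewrite ltNge x0.
exists n; rewrite xn andbT leNgt; apply/negP => /hn.
by rewrite ltnn.
Qed.

Lemma tau_index_inj x m n : tau m <= x < tau m.+1 -> tau n <= x < tau n.+1 -> m = n.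
Proof.
move=> /andP[m1 m2] /andP[n1 n2]; apply/eqP; rewrite eqn_leq.
apply/andP; split; rewrite leqNgt; apply/negP => /tau_mono h.
  by have := le_lt_trans (le_trans h m1) n2; rewrite ltxx.
by have := le_lt_trans (le_trans h n1) m2; rewrite ltxx.
Qed.

(** * Forward and backward growth estimates, convergence at infinity *)

Section Bounds.
Context (u : R -> 'cV[R[i]]_p) (hu : piecewise_sol u).

Lemma piece_increment n x y : tau n <= x -> x <= y -> y <= tau n.+1 ->
  N (u y - u x) <= (G y - G x) * N (u (zeta n)).
Proof.
move=> nx xy yn.
have hx : tau n <= x <= tau n.+1 by rewrite nx (le_trans xy).
have hy : tau n <= y <= tau n.+1 by rewrite yn (le_trans nx).
rewrite (hu.2 _ _ hx) (hu.2 _ _ hy).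
rewrite opprD addrACA subrr add0r opprB subrKA.
by apply: hA => //; apply: le_trans nx; apply: tau0_le.
Qed.

(** [u (zeta n)] differs from [u (tau n)] by at most [nup * N (u (zeta n))], which is absorbed on
    the left because [nup < 1]. *)
Lemma zeta_bound_left n : N (u (zeta n)) <= N (u (tau n)) / (1 - nup).
Proof.
have /andP[z1 z2] := tau_zeta n.
rewrite ler_pdivlMr ?subr_gt0 //.
have h := piece_increment (lexx (tau n)) z1 z2.
have := is_norm_subr_le hN (u (zeta n)) (u (tau n)).
have := ler_wpM2r (is_norm_ge0 hN (u (zeta n))) (hGp n).
by lra.
Qed.

Lemma zeta_bound_right n : N (u (zeta n)) <= N (u (tau n.+1)) / (1 - num).
Proof.
have /andP[z1 z2] := tau_zeta n.
rewrite ler_pdivlMr ?subr_gt0 //.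
have h := piece_increment z1 z2 (lexx _).
have := is_norm_subr_le hN (u (zeta n)) (u (tau n.+1)).
have := ler_wpM2r (is_norm_ge0 hN (u (zeta n))) (hGm n).
by rewrite (is_normC hN); lra.
Qed.

(** Bounding [u (zeta n)] by [u (tau n)] gives the factor [1 + (G x - G (tau n)) / (1 - nup)]. Its
    exponential bound makes successive factors telescope. *)
Lemma forward_step n x : tau n <= x -> x <= tau n.+1 ->
  N (u x) <= N (u (tau n)) * expR ((G x - G (tau n)) / (1 - nup)).
Proof.
move=> nx xn.
have g0 : 0 <= G x - G (tau n) by rewrite subr_ge0 hG ?tau0_le.
have h := piece_increment (lexx (tau n)) nx xn.
have h2 := ler_wpM2l g0 (zeta_bound_left n).
apply: le_trans (_ : N (u (tau n)) * (1 + (G x - G (tau n)) / (1 - nup)) <= _).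
  have := is_norm_subr_le hN (u x) (u (tau n)).
  by rewrite mulrDr mulr1 [_ / (1 - nup)]mulrC; lra.
by rewrite ler_wpM2l ?is_norm_ge0 // expR_ge1Dx.
Qed.

Lemma backward_step n :
  N (u (tau n)) <= N (u (tau n.+1)) * expR ((G (tau n.+1) - G (tau n)) / (1 - num)).
Proof.
have nx := ltW (tauS n).
have g0 : 0 <= G (tau n.+1) - G (tau n) by rewrite subr_ge0 hG ?tau0_le.
have h := piece_increment (lexx (tau n)) nx (lexx _).
have h2 := ler_wpM2l g0 (zeta_bound_right n).
apply: le_trans (_ : N (u (tau n.+1)) * (1 + (G (tau n.+1) - G (tau n)) / (1 - num)) <= _).
  have := is_norm_subr_le hN (u (tau n)) (u (tau n.+1)).
  rewrite (is_normC hN).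
  by rewrite mulrDr mulr1 [_ / (1 - num)]mulrC; lra.
by rewrite ler_wpM2l ?is_norm_ge0 // expR_ge1Dx.
Qed.

Lemma forward_bound x : tau 0 <= x ->
  N (u x) <= N (u (tau 0)) * expR ((G x - G (tau 0)) / (1 - nup)).
Proof.
move=> x0.
have htau n : N (u (tau n)) <= N (u (tau 0)) * expR ((G (tau n) - G (tau 0)) / (1 - nup)).
  elim: n => [|n IH]; first by rewrite subrr mul0r expR0 mulr1.
  apply: le_trans (forward_step (ltW (tauS n)) (lexx _)) _.
  apply: le_trans (ler_wpM2r (expR_ge0 _) IH) _.
  by rewrite -mulrA -expRD -mulrDl [_ + (_ - _)]addrC subrKA.
have [n /andP[nx xn]] := tau_cover x0.
apply: le_trans (forward_step nx (ltW xn)) _.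
apply: le_trans (ler_wpM2r (expR_ge0 _) (htau n)) _.
by rewrite -mulrA -expRD -mulrDl [_ + (_ - _)]addrC subrKA.
Qed.

Lemma piecewise_sol_bound x : tau 0 <= x ->
  N (u x) <= expR (K / (1 - nup)) * N (u (tau 0)).
Proof.
move=> x0; apply: le_trans (forward_bound x0) _; rewrite mulrC.
rewrite ler_wpM2r ?is_norm_ge0 // ler_expR ler_wpM2r ?invr_ge0 ?hGK //.
by rewrite subr_ge0 ltW.
Qed.

(** Going back from [tau n] to [tau 0] costs a factor independent of [n], so a nonzero solution
    stays away from 0 along the grid. *)
Lemma piecewise_sol_bound_below n :
  N (u (tau 0)) <= expR (K / (1 - num)) * N (u (tau n)).
Proof.
apply: le_trans (_ : N (u (tau n)) * expR ((G (tau n) - G (tau 0)) / (1 - num)) <= _).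
  elim: n => [|n IH]; first by rewrite subrr mul0r expR0 mulr1.
  apply: le_trans IH _; apply: le_trans (ler_wpM2r (expR_ge0 _) (backward_step n)) _.
  by rewrite -mulrA -expRD -mulrDl subrKA.
rewrite mulrC ler_wpM2r ?is_norm_ge0 // ler_expR ler_wpM2r ?invr_ge0 ?hGK ?tau0_le //.
by rewrite subr_ge0 ltW.
Qed.

(** On one piece this is [piece_increment] with [u (zeta n)] bounded by [M]; longer intervals are
    cut at grid points by induction. *)
Lemma piecewise_sol_increment x y : tau 0 <= x -> x <= y ->
  N (u y - u x) <= (G y - G x) * (expR (K / (1 - nup)) * N (u (tau 0))).
Proof.
set M := expR _ * _.
have hz n : N (u (zeta n)) <= M.
  apply: piecewise_sol_bound; have /andP[z _] := tau_zeta n.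
  by apply: le_trans z; apply: tau0_le.
have piece n a b : tau n <= a -> a <= b -> b <= tau n.+1 ->
    N (u b - u a) <= (G b - G a) * M.
  move=> na ab bn; apply: le_trans (piece_increment na ab bn) _.
  by rewrite ler_wpM2l // subr_ge0 hG // (le_trans (tau0_le n)).
have main n : forall a b, tau 0 <= a -> a <= b -> b <= tau n ->
    N (u b - u a) <= (G b - G a) * M.
  elim: n => [|n IH] a b a0 ab bn.
    have -> : b = a by apply: le_anti; rewrite ab (le_trans bn).
    by rewrite !subrr mul0r is_norm0.
  have [bn'|nb] := leP b (tau n); first exact: IH.
  have [na|an] := leP (tau n) a; first exact: piece na ab bn.
  have h1 := IH _ _ a0 (ltW an) (lexx _).
  have h2 := piece n _ _ (lexx _) (ltW nb) bn.
  by have := is_norm_triangleB hN (u (tau n)) (u b) (u a); lra.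
move=> x0 xy; have [n yn] := tau_unbounded y.
by apply: (main n) => //; apply: ltW.
Qed.

(** Real and imaginary parts of each coordinate have increments dominated by those of the bounded
    function [C * M * G], so each converges. *)
Lemma piecewise_sol_cvg : exists l, norm_cvg N +oo u l.
Proof.
have [C C0 hC] := l1_le_is_norm hN; have [D D0 hD] := is_norm_le_l1 hN.
set M := expR (K / (1 - nup)) * N (u (tau 0)).
have M0 : 0 <= C * M by rewrite mulr_ge0 // mulr_ge0 ?expR_ge0 ?is_norm_ge0.
have entry x y j : tau 0 <= x -> x <= y ->
    `|complex.Re (u y j 0) - complex.Re (u x j 0)| +
    `|complex.Im (u y j 0) - complex.Im (u x j 0)| <= C * M * G y - C * M * G x.
  move=> x0 xy; apply: le_trans (_ : l1norm (u y - u x) <= _).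
    rewrite /l1norm (bigD1 j) //= !mxE.
    case: (u y j 0) (u x j 0) => [a b] [c d] /=; rewrite lerDl.
    by apply: sumr_ge0 => i _; apply: addr_ge0.
  apply: le_trans (hC _) _; rewrite -mulrBr -mulrA ler_wpM2l // mulrC.
  exact: piecewise_sol_increment.
have CG x : tau 0 <= x -> C * M * G x - C * M * G (tau 0) <= C * M * K.
  by move=> x0; rewrite -mulrBr ler_wpM2l // hGK.
have hre j : exists l : R, complex.Re (u x j 0) @[x --> +oo] --> l.
  apply: (@cvgy_of_increments_le _ (tau 0) _ _ (fun x => C * M * G x)) CG => x y x0 xy.
  by apply: le_trans (entry _ _ j x0 xy); rewrite lerDl.
have him j : exists l : R, complex.Im (u x j 0) @[x --> +oo] --> l.
  apply: (@cvgy_of_increments_le _ (tau 0) _ _ (fun x => C * M * G x)) CG => x y x0 xy.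
  by apply: le_trans (entry _ _ j x0 xy); rewrite lerDr.
have [[lr hlr] [li hli]] := (choice hre, choice him).
exists (\col_j (lr j +i* li j)).
apply: (@squeeze_cvgr _ _ _ _ (fun=> 0)
  (fun x => D * \sum_j (`|complex.Re (u x j 0) - lr j| + `|complex.Im (u x j 0) - li j|))).
- near=> x; rewrite is_norm_ge0 //=; apply: le_trans (hD _) _.
  rewrite ler_wpM2l // ler_sum // => j _; rewrite !mxE.
  by case: (u x j 0) => a b /=.
- exact: cvg_cst.
- rewrite -[X in _ --> X](mulr0 D); apply: cvgMr.
  rewrite [X in _ --> X](_ : 0 = \sum_(j < p) (0 : R)); last by rewrite big1.
  apply: cvg_big => [|j _]; first exact: add_continuous.
  rewrite -[X in _ --> X](addr0 0); apply: cvgD.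
    by apply/norm_cvg0P; rewrite -[X in _ --> X](subrr (lr j)); apply: cvgB => //; apply: cvg_cst.
  by apply/norm_cvg0P; rewrite -[X in _ --> X](subrr (li j)); apply: cvgB => //; apply: cvg_cst.
Unshelve. all: by end_near. Qed.

End Bounds.

(** * Linearity, existence, uniqueness and prescribed limits *)

Lemma piecewise_sol_sum (c : 'I_p -> R[i]) (u : 'I_p -> R -> 'cV[R[i]]_p) :
  (forall j, piecewise_sol (u j)) -> piecewise_sol (fun x => \sum_j c j *: u j x).
Proof.
move=> hu; split=> [x x0|n x hx].
  by rewrite big1 // => j _; rewrite (hu j).1 // scaler0.
rewrite !mulmx_sumr -sumrB -big_split /=; apply: eq_bigr => j _.
by rewrite {1}((hu j).2 _ _ hx) -!scalemxAr -scalerBr -scalerDr.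
Qed.

Lemma piecewise_solB u v :
  piecewise_sol u -> piecewise_sol v -> piecewise_sol (fun x => u x - v x).
Proof.
move=> hu hv; split=> [x x0|n x hx].
  by rewrite hu.1 // hv.1 // subrr.
rewrite !mulmxBr (hu.2 _ _ hx) (hv.2 _ _ hx).
by rewrite opprD addrACA; congr (_ + _); rewrite opprD opprK addrACA opprB [- _ + _]addrC.
Qed.

Lemma piecewise_sol_eq0 u : piecewise_sol u -> u (tau 0) = 0 -> u = fun=> 0.
Proof.
move=> hu u0; apply: funext => x; have [x0|x0] := ltP x (tau 0); first exact: hu.1.
apply: (is_norm0_eq0 hN); apply: le_anti.
rewrite is_norm_ge0 // andbT.
by apply: le_trans (piecewise_sol_bound hu x0) _; rewrite u0 is_norm0 // mulr0.
Qed.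

Lemma piecewise_sol_inj u v :
  piecewise_sol u -> piecewise_sol v -> u (tau 0) = v (tau 0) -> u = v.
Proof.
move=> hu hv uv; have h := piecewise_solB hu hv.
apply: funext => x; apply/eqP; rewrite -subr_eq0; apply/eqP.
have h0 : u (tau 0) - v (tau 0) = 0 by rewrite uv subrr.
exact: (congr1 (fun f => f x) (piecewise_sol_eq0 h h0)).
Qed.

(** This matrix sends [u (zeta n)] to [u (tau n)]. A kernel vector satisfies [N x <= nup * N x],
    hence vanishes. *)
Lemma left_transfer_unit n : 1%:M + (A (tau n) - A (zeta n)) \in unitmx.
Proof.
apply: unitmx_of_injective => x; rewrite mulmxDl mul1mx mulmxBl => hx.
have /andP[z1 z2] := tau_zeta n.
have : N x <= nup * N x.
  rewrite [leLHS](_ : _ = N (A (zeta n) *m x - A (tau n) *m x)); last first.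
    by congr N; apply/eqP; rewrite -subr_eq0 opprB hx.
  apply: le_trans (hA _ (tau0_le n) z1) _.
  by apply: ler_wpM2r => //; apply: is_norm_ge0.
move=> h; apply: (is_norm0_eq0 hN); apply: le_anti.
rewrite is_norm_ge0 // andbT.
have : (1 - nup) * N x <= 0 by lra.
by rewrite pmulr_rle0 // subr_gt0.
Qed.

(** Recursion over the pieces: from the value [cs n] at [tau n], inverting the transfer matrix gives
    the value at [zeta n], which determines the whole piece and [cs n.+1]. *)
Lemma piecewise_sol_exists c : exists u, piecewise_sol u /\ u (tau 0) = c.
Proof.
pose z n (v : 'cV[R[i]]_p) := invmx (1%:M + (A (tau n) - A (zeta n))) *m v.
have zE n v : z n v + (A (tau n) *m z n v - A (zeta n) *m z n v) = v.
  by rewrite -{1}[z n v]mul1mx -mulmxBl -mulmxDl mulKVmx ?left_transfer_unit.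
pose cs := fix cs n := if n is m.+1 then
  z m (cs m) + (A (tau m.+1) *m z m (cs m) - A (zeta m) *m z m (cs m)) else c.
pose w n x := z n (cs n) + (A x *m z n (cs n) - A (zeta n) *m z n (cs n)).
have /choice[k hk] : forall x, exists n, tau 0 <= x -> tau n <= x < tau n.+1.
  move=> x; have [x0|x0] := leP (tau 0) x; last by exists 0%N.
  by have [n hn] := tau_cover x0; exists n.
pose u x := if x < tau 0 then 0 else w (k x) x.
have uE n x : tau n <= x <= tau n.+1 -> u x = w n x.
  move=> /andP[nx xn]; have x0 : tau 0 <= x by apply: le_trans nx; apply: tau0_le.
  (* At the right end [x = tau n.+1] the chosen index is [n.+1], not [n]; the two formulas agree
     because piece [n.+1] starts at [cs n.+1]. *)
  rewrite /u ltNge x0 /=; move: xn; rewrite le_eqVlt => /orP[/eqP xE|xn]; last first.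
    have nxn : tau n <= x < tau n.+1 by rewrite nx.
    by rewrite (tau_index_inj (hk x x0) nxn).
  have xn1 : tau n.+1 <= x < tau n.+2 by rewrite xE lexx tauS.
  by rewrite (tau_index_inj (hk x x0) xn1) xE /w zE.
have uz n : u (zeta n) = z n (cs n).
  by rewrite (uE n) // /w subrr addr0.
exists u; split; last first.
  by rewrite (uE 0%N) ?lexx ?ltW // /w zE.
split=> [x x0|n x hx]; first by rewrite /u x0.
by rewrite (uE n) // uz.
Qed.

Lemma piecewise_sol_cvg0 u : piecewise_sol u -> norm_cvg N +oo u 0 -> u (tau 0) = 0.
Proof.
move=> hu /cvgrPdist_le u0; apply: (is_norm0_eq0 hN); apply: le_anti.
rewrite is_norm_ge0 // andbT; apply/ler_addgt0Pr => e e0; rewrite add0r.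
set E := expR (K / (1 - num)).
have E0 : 0 < E by apply: expR_gt0.
have [X [_ hX]] := u0 (e / E) (divr_gt0 e0 E0).
have [n Xn] := tau_unbounded X.
apply: le_trans (piecewise_sol_bound_below hu n) _.
move: (hX _ Xn); rewrite /= subr0 sub0r normrN ger0_norm ?is_norm_ge0 //.
by rewrite ler_pdivlMr // mulrC.
Qed.

(** The solutions starting at the basis vectors span all solutions, so the limit is a linear
    function of the initial value. It is injective by [piecewise_sol_cvg0], hence invertible in
    finite dimension. *)
Lemma piecewise_sol_cvg_exists uh : exists u, piecewise_sol u /\ norm_cvg N +oo u uh.
Proof.
have /choice[s hs] : forall j : 'I_p, exists s, piecewise_sol s /\ s (tau 0) = delta_mx j 0.
  by move=> j; apply: piecewise_sol_exists.
have /choice[l hl] : forall j, exists l, norm_cvg N +oo (s j) l.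
  by move=> j; apply: piecewise_sol_cvg; have [] := hs j.
(* The matrix of the map sending an initial value to the limit. *)
pose P : 'M[R[i]]_p := \matrix_(i, j) l j i 0.
have PE c : P *m c = \sum_j c j 0 *: l j.
  apply/colP => i; rewrite summxE mxE; apply: eq_bigr => j _.
  by rewrite !mxE mulrC.
pose U c x := \sum_j (c : 'cV_p) j 0 *: s j x.
have hU c : piecewise_sol (U c).
  by apply: piecewise_sol_sum => j; have [] := hs j.
have U0 c : U c (tau 0) = c.
  rewrite [RHS]matrix_sum_delta; apply: eq_bigr => j _.
  by rewrite big_ord1; have [_ ->] := hs j.
have U_cvg c : norm_cvg N +oo (U c) (P *m c).
  apply: (@squeeze_cvgr _ _ _ _ (fun=> 0)
    (fun x => \sum_j Normc.normc (c j 0) * N (s j x - l j))).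
  - near=> x; rewrite is_norm_ge0 //= PE /U -sumrB.
    apply: le_trans (is_norm_sum hN _ _ _) _.
    by apply: ler_sum => j _; rewrite -scalerBr is_normZ.
  - exact: cvg_cst.
  - rewrite [X in _ --> X](_ : 0 = \sum_(j < p) (0 : R)); last by rewrite big1.
    apply: cvg_big => [|j _]; first exact: add_continuous.
    by rewrite -[X in _ --> X](mulr0 (Normc.normc (c j 0))); apply: cvgMr; apply: hl.
have Punit : P \in unitmx.
  apply: unitmx_of_injective => c Pc0; rewrite -(U0 c).
  by apply: piecewise_sol_cvg0 => //; rewrite -Pc0.
exists (U (invmx P *m uh)); split => //.
by rewrite -[X in norm_cvg _ _ _ X](mulKVmx Punit uh).
Unshelve. all: by end_near. Qed.

Lemma norm_cvgB (F : set_system R) (FF : Filter F) (u v : R -> 'cV[R[i]]_p) a b :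
  norm_cvg N F u a -> norm_cvg N F v b -> norm_cvg N F (fun x => u x - v x) (a - b).
Proof.
move=> ha hb; apply: (@squeeze_cvgr _ _ _ _ (fun=> 0) (fun x => N (u x - a) + N (v x - b))).
- near=> x; rewrite is_norm_ge0 //= -(is_normN hN (v x - b)).
  rewrite (_ : u x - v x - (a - b) = u x - a - (v x - b)); first exact: is_norm_triangle.
  by rewrite !opprD !opprK addrACA.
- exact: cvg_cst.
- by rewrite -[X in _ --> X](addr0 0); apply: cvgD.
Unshelve. all: by end_near. Qed.

Lemma piecewise_sol_cvg_unique u v uh : piecewise_sol u -> piecewise_sol v ->
  norm_cvg N +oo u uh -> norm_cvg N +oo v uh -> u = v.
Proof.
move=> hu hv cu cv; apply: piecewise_sol_inj => //; apply/eqP.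
rewrite -subr_eq0; apply/eqP.
apply: (@piecewise_sol_cvg0 (fun x => u x - v x)); first exact: piecewise_solB.
by rewrite -(subrr uh); apply: norm_cvgB.
Qed.

Lemma supnorm_le u : piecewise_sol u ->
  supnorm N (tau 0) u <= expR (K / (1 - nup)) * N (u (tau 0)).
Proof.
move=> hu; apply: ge_sup => [|_ [x /= + <-]].
  by exists (N (u (tau 0))), (tau 0); rewrite //= in_itv /= lexx.
by rewrite in_itv /= andbT => /(piecewise_sol_bound hu).
Qed.

(** Boundedness of [u] ensures that [sup] is a genuine supremum and not a default value. *)
Lemma supnorm_ge u : piecewise_sol u -> N (u (tau 0)) <= supnorm N (tau 0) u.
Proof.
move=> hu; apply: ub_le_sup.
  exists (expR (K / (1 - nup)) * N (u (tau 0))) => _ [x /= + <-].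
  by rewrite in_itv /= andbT => /(piecewise_sol_bound hu).
by exists (tau 0); rewrite //= in_itv /= lexx.
Qed.

(** The inverse is evaluation at [tau 0]. Differences of solutions are solutions, so both maps are
    Lipschitz, with constants [expR (K / (1 - nup))] and 1. *)
Lemma piecewise_sol_homeomorphic :
  homeomorphic (fun x y : 'cV[R[i]]_p => N (x - y))
    (fun u v : R -> 'cV[R[i]]_p => supnorm N (tau 0) (fun s => u s - v s))
    setT piecewise_sol.
Proof.
have [f hf] := choice piecewise_sol_exists.
exists f, (fun u => u (tau 0)); split.
- by move=> c _; have [? ?] := hf c.
- move=> u hu; split=> //; have [h h0] := hf (u (tau 0)).
  exact: piecewise_sol_inj.
- move=> c _ e e0; set E := expR (K / (1 - nup)).
  have E0 : 0 < E by apply: expR_gt0.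
  exists (e / E) => [|c' _]; first exact: divr_gt0.
  rewrite ltr_pdivlMr // mulrC; apply: le_lt_trans.
  have [[h1 h2] [h3 h4]] := (hf c, hf c').
  by have := supnorm_le (piecewise_solB h1 h3); rewrite h2 h4.
- move=> u hu e e0; exists e => // v hv; apply: le_lt_trans.
  exact: (supnorm_ge (piecewise_solB hu hv)).
Qed.

End PiecewiseSolutions.

(** * Equivalence with the differential equation *)

Section SolutionCharacterization.
Context {R : realType} {p : nat} {N : 'cV[R[i]]_p -> R} (hN : is_norm N).
Context (t zeta : int -> R) (gamma : R -> R) (B : R -> 'M[R[i]]_p) (a : R).
Context (hgrid : admissible_grid t zeta) (hgamma : is_gamma t zeta gamma).
Context (hB : forall x : R, norm_cvg (induced_norm N) (nbhs x) B (B x)).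
Context (at0 : a < t 0).

Let tau (n : nat) : R := t n%:Z.
Let zt (n : nat) : R := zeta n%:Z.
Local Notation A := (mx_primitive a B).
Local Notation G := (primitive a (fun s => induced_norm N (B s))).

Lemma grid_natS n : t (n%:Z + 1) = t n.+1%:Z.
Proof. by rewrite intS addrC. Qed.

Lemma grid_lt n : t n%:Z < t n.+1%:Z.
Proof. by rewrite -grid_natS; case: hgrid. Qed.

Lemma grid_zeta n : t n%:Z <= zeta n%:Z <= t n.+1%:Z.
Proof. by rewrite -grid_natS; case: hgrid. Qed.

Lemma grid_unbounded x : exists n : nat, x < t n%:Z.
Proof.
case: hgrid => _ _ /cvgryPgt/(_ x)[n _ hn] _.
by exists n; apply: hn => /=.
Qed.

Lemma gamma_piece n x : tau n <= x < tau n.+1 -> gamma x = zt n.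
Proof. by move=> h; apply: hgamma; rewrite grid_natS. Qed.

Let t0_le n : t 0 <= tau n := tau0_le grid_lt n.

(** On a piece, with [c = u (zt n)], the function [w x = u x - A x *m c] has zero derivative inside,
    hence is constant there; continuity extends this to both endpoints. *)
Lemma solution_piecewise u :
  is_solution N t gamma B u -> piecewise_sol tau zt A u.
Proof.
move=> [u0 uc ud _ _]; split=> // n.
set c := u (zt n); pose w x := u x - A x *m c.
have ax x : tau n <= x -> a < x.
  by move=> h; apply: lt_le_trans h; apply: lt_le_trans at0 _; apply: t0_le.
have w_const x y : tau n < x -> x <= y -> y < tau n.+1 -> w y = w x.
  move=> nx xy yn; apply/eqP; rewrite -subr_eq0; apply/eqP/(is_norm0_eq0 hN).
  apply: le_anti; rewrite is_norm_ge0 // andbT -(subrr (0 : R)).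
  apply: (norm_increment_le hN (G := fun=> 0)) => // s /andP[xs sy] e e0.
  have e2 : 0 < e / 2 by rewrite divr_gt0.
  have ns : tau n < s by apply: lt_le_trans xs.
  have sn : s < tau n.+1 by apply: le_lt_trans yn.
  have hs : t n%:Z < s < t (n%:Z + 1) by rewrite grid_natS ns.
  have := ud n%:Z s isT hs.
  rewrite (@gamma_piece n) ?(ltW ns) // -/c => /(diff_quot_cvgP hN) h.
  have {}h := h (fun _ => id) _ e2.
  apply: filterS2 h (mx_primitive_deriv hN hB c (ax _ (ltW ns)) e2) => r h1 h2 _.
  apply: le_trans (_ : e * `|r - s| <= _); last by rewrite lerDr.
  have [->|rs] := eqVneq r s; first by rewrite !subrr is_norm0 // normr0 mulr0.
  have {}h1 := h1 rs.
  rewrite /w (_ : _ - _ = (u r - u s - (r - s)%:C *: (B s *m c)) -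
    (A r *m c - A s *m c - (r - s)%:C *: (B s *m c))).
    apply: le_trans (is_norm_triangle hN _ _) _.
    by rewrite (is_normN hN); lra.
  by rewrite [in RHS]opprB subrKA !opprD !opprK addrACA.
pose m := (tau n + tau n.+1) / 2.
have tn := grid_lt n; rewrite -/(tau n) -/(tau n.+1) in tn.
have w_mid x : tau n <= x <= tau n.+1 -> w x = w m.
  move=> /andP[nx xn]; apply/eqP; rewrite -subr_eq0; apply/eqP/(is_norm0_eq0 hN).
  apply: le_anti; rewrite is_norm_ge0 // andbT; apply/ler_addgt0Pr => e e0.
  rewrite add0r; have e2 : 0 < e / 2 by rewrite divr_gt0.
  have x0 : t 0 <= x by apply: le_trans nx; apply: t0_le.
  have /cvgrPdist_le/(_ _ e2) := uc x x0; rewrite near_withinE => h.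
  have hA := mx_primitive_continuous hN hB c (ax _ nx) e2.
  have /nbhs_ballP[d /= d0 hd] : \forall y \near x,
      (y \in `[t 0, +oo[ -> N (u y - u x) <= e / 2) /\ N (A y *m c - A x *m c) <= e / 2.
    apply: filterS2 h hA => y h1 h2; split=> // /h1.
    by rewrite sub0r normrN ger0_norm // is_norm_ge0.
  have close y : t 0 <= y -> `|x - y| < d -> N (w x - w y) <= e.
    move=> y0 xy; have [] := hd y xy.
    rewrite in_itv /= y0 => /(_ isT) h1 h2.
    rewrite (is_normC hN) /w (_ : _ - _ = (u y - u x) - (A y *m c - A x *m c)).
      apply: le_trans (is_norm_triangle hN _ _) _.
      by rewrite (is_normN hN); lra.
    by rewrite !opprD !opprK addrACA.
  have mE : 2 * m = tau n + tau n.+1 by rewrite mulrC mulfVK.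
  have n0 := t0_le n.
  (* A move from [x] towards the midpoint by less than [d] enters the open piece, where [w] equals
     [w m]. *)
  have [xm|mx|->] := ltgtP x m; last by rewrite subrr is_norm0 // ltW.
    have [y [xy ym yd]] : exists y, [/\ x < y, y <= m & y < x + d].
      exists (Num.min m (x + d / 2)); rewrite lt_min ge_min gt_min lexx xm /=.
      by split=> //; [lra|apply/orP; right; lra].
    rewrite (w_const y m) => [|||]; [|lra..].
    by apply: close; [lra|rewrite ltr0_norm; lra].
  have [y [xy ym yd]] : exists y, [/\ y < x, m <= y & x - d < y].
    exists (Num.max m (x - d / 2)); rewrite gt_max le_max lt_max lexx mx /=.
    by split=> //; [lra|apply/orP; right; lra].
  rewrite -(w_const m y) => [|||]; [|lra..].
  by apply: close; [lra|rewrite gtr0_norm; lra].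
move=> x /w_mid wx; have /w_mid wz := grid_zeta n.
have : w x = w (zt n) := etrans wx (esym wz).
rewrite /w -/c => /eqP; rewrite subr_eq => /eqP ->.
by rewrite -addrA [- _ + _]addrC.
Qed.

(** Treats interior points and both one-sided derivatives: []al, be[] is a neighbourhood of [x] in
    which the points of [D] belong to piece [n]. *)
Lemma piecewise_diff_quot u (D : set R) (al be x : R) n :
  piecewise_sol tau zt A u -> tau n <= x <= tau n.+1 -> al < x < be ->
  (forall y, D y -> y != x) ->
  (forall y, D y -> al < y < be -> tau n <= y <= tau n.+1) ->
  norm_cvg N (within D (nbhs x)) (diff_quot u x) (B x *m u (zt n)).
Proof.
move=> hu hx xab Dx hD; apply/(diff_quot_cvgP hN _ _ Dx) => e e0.
have ax : a < x.
  by case/andP: hx => nx _; apply: lt_le_trans nx; apply: lt_le_trans at0 (t0_le n).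
have hab : \forall y \near x, y \in `]al, be[ by apply: near_in_itvoo; rewrite in_itv.
apply: filterS2 hab (mx_primitive_deriv hN hB (u (zt n)) ax e0) => y + h Dy.
rewrite in_itv /= => /(hD y Dy) hy.
by rewrite (hu.2 _ _ hx) (hu.2 _ _ hy) opprD addrACA subrr add0r opprB subrKA.
Qed.

(** The increment bound holds across grid points, so [u] inherits continuity from [G] without gluing
    pieces. *)
Lemma piecewise_solution (L : R) u :
  (forall x y, t 0 <= x -> x <= y -> N (u y - u x) <= (G y - G x) * L) ->
  piecewise_sol tau zt A u -> is_solution N t gamma B u.
Proof.
move=> hL hu; split.
- exact: hu.1.
- move=> x x0; have cG : {for x, continuous G}.
    apply: primitive_continuous; first exact: continuous_induced_norm.
    exact: lt_le_trans x0.
  apply: (@squeeze_cvgr _ _ _ _ (fun=> 0) (fun y => `|G y - G x| * `|L|)).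
  + near=> y; rewrite is_norm_ge0 //= -normrM.
    have y0 : t 0 <= y.
      have : `[t 0, +oo[%classic y by near: y; apply: withinT.
      by rewrite /= in_itv /= andbT.
    have [xy|/ltW yx] := leP x y.
      by apply: le_trans (hL _ _ x0 xy) _; apply: ler_norm.
    rewrite (is_normC hN); apply: le_trans (hL _ _ y0 yx) _.
    by rewrite -normrN -mulNr opprB; apply: ler_norm.
  + exact: cvg_cst.
  + apply: cvg_within_filter.
    suff : (fun y => `|G y - G x| * `|L|) @ x --> `|G x - G x| * `|L|.
      by rewrite subrr normr0 mul0r.
    apply: cvgMl; apply: cvg_norm; apply: (@cvgB _ _ _ _ _ G (fun=> G x)) => //.
    exact: cvg_cst.
- move=> [n|//] x _; rewrite grid_natS => hx.
  rewrite (@gamma_piece n); last by case/andP: hx => /ltW -> ->.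
  apply: (piecewise_diff_quot hu _ hx) => //.
    by case/andP: hx => /ltW -> /ltW ->.
  by move=> y _ /andP[/ltW -> /ltW ->].
- move=> [n|//] _; have tn := grid_lt n.
  rewrite (@gamma_piece n); last by rewrite lexx.
  apply: (@piecewise_diff_quot _ _ (t n%:Z - 1) (t n.+1%:Z) _ n hu).
  + by rewrite lexx ltW.
  + by rewrite tn gtrBl ltr01.
  + by move=> y /gt_eqF ->.
  + by move=> y /ltW ny /andP[_ /ltW yn]; rewrite ny yn.
- move=> [[//|n]|//] _; have tn := grid_lt n.
  (* The left derivative at [t n.+1] is governed by piece [n], hence [zt n] and not [zt n.+1]. *)
  exists (B (t n.+1%:Z) *m u (zt n)).
  apply: (@piecewise_diff_quot _ _ (t n%:Z) (t n.+1%:Z + 1) _ n hu).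
  + by rewrite lexx ltW.
  + by rewrite tn ltrDl ltr01.
  + by move=> y /lt_eqF ->.
  + by move=> y /ltW yn /andP[/ltW ny _]; rewrite ny yn.
Unshelve. all: by end_near. Qed.

End SolutionCharacterization.

Theorem corollary5p2 (R : realType) (p : nat) (N : 'cV[R[i]]_p -> R)
    (t zeta : int -> R) (gamma : R -> R) (B : R -> 'M[R[i]]_p)
    (nup num : R)
    (hN : is_norm N)
    (hgrid : admissible_grid t zeta)
    (hgamma : is_gamma t zeta gamma)
    (hBcont : forall x : R, norm_cvg (induced_norm N) (nbhs x) B (B x))
    (hBint : (@lebesgue_measure R).-integrable `[t 0, +oo[
               (fun s => (induced_norm N (B s))%:E))
    (hnup : nup < 1) (hnum : num < 1)
    (hBp : forall i : int,
       (\int[@lebesgue_measure R]_(s in `[t i, zeta i])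
          (induced_norm N (B s))%:E <= nup%:E)%E)
    (hBm : forall i : int,
       (\int[@lebesgue_measure R]_(s in `]zeta i, t (i + 1)%R[)
          (induced_norm N (B s))%:E <= num%:E)%E) :
  [/\ homeomorphic (fun x y : 'cV[R[i]]_p => N (x - y))
        (fun u v : R -> 'cV[R[i]]_p =>
           supnorm N (tstar t gamma) (fun s => u s - v s))
        setT (bounded_solutions N t gamma B),
      forall u : R -> 'cV[R[i]]_p, is_solution N t gamma B u ->
        exists uh : 'cV[R[i]]_p, norm_cvg N +oo u uh
    & forall uh : 'cV[R[i]]_p,
        exists! u : R -> 'cV[R[i]]_p,
          is_solution N t gamma B u /\ norm_cvg N +oo u uh].
Proof.
(* The primitives start strictly before [t 0], so that they are differentiable at [t 0] as well. *)
pose a := t 0 - 1; have at0 : a < t 0 by rewrite gtrBl ltr01.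
pose b s := induced_norm N (B s); pose G := primitive a b.
pose A := mx_primitive a B.
pose tau (n : nat) := t n%:Z; pose zt (n : nat) := zeta n%:Z.
have cb : continuous b := continuous_induced_norm hN hBcont.
have b0 s : 0 <= b s by apply: induced_norm_ge0.
have tauS n : tau n < tau n.+1 := grid_lt hgrid n.
have tau_zeta n : tau n <= zt n <= tau n.+1 := grid_zeta hgrid n.
have taux x : exists n, x < tau n := grid_unbounded hgrid x.
have a_le x : t 0 <= x -> a <= x by move=> h; apply: le_trans (ltW at0) h.
have t0_le n : t 0 <= tau n := tau0_le tauS n.
have hA v x y : tau 0%N <= x -> x <= y -> N (A y *m v - A x *m v) <= (G y - G x) * N v.
  by move=> x0 xy; apply: mx_primitive_increment => //; apply: lt_le_trans x0.
have hG x y : tau 0%N <= x -> x <= y -> G x <= G y.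
  by move=> x0; apply: primitive_nondecreasing => //; apply: a_le.
have mb (D : set R) : measurable_fun D (fun s => (b s)%:E).
  by apply: measurable_funTS; apply/measurable_EFinP; apply: continuous_measurable_fun.
have hGp n : G (zt n) - G (tau n) <= nup.
  have /andP[z1 _] := tau_zeta n.
  rewrite -lee_fin primitiveB ?a_le //; apply: le_trans (hBp n%:Z).
  by rewrite (integral_itv_bndoo true false).
have hGm n : G (tau n.+1) - G (zt n) <= num.
  have /andP[z1 z2] := tau_zeta n.
  rewrite -lee_fin primitiveB ?a_le //; last exact: le_trans z1.
  by apply: le_trans (hBm n%:Z); rewrite grid_natS.
(* The total mass of [|B|] on [[t 0, +oo[], finite by integrability, bounds the growth of [G]. *)
pose K := fine (\int[@lebesgue_measure R]_(s in `[t 0%R, +oo[) (b s)%:E)%E.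
have hGK x : tau 0%N <= x -> G x - G (tau 0%N) <= K.
  move=> x0; rewrite -lee_fin primitiveB ?a_le //.
  rewrite /K fineK; last exact: integrable_fin_num.
  apply: ge0_subset_integral => //.
  - exact: mb.
  - by move=> s _; rewrite lee_fin.
  - by apply: subset_itv; rewrite bnd_simp.
have sol_iff u : is_solution N t gamma B u <-> piecewise_sol tau zt A u.
  split; first exact: solution_piecewise.
  move=> hu; have h := piecewise_sol_increment hN tauS tau_zeta taux hnup hA hG hGp hGK hu.
  exact: (piecewise_solution hN hgrid hgamma hBcont at0 h hu).
(* [gamma (t 0)] is [zeta 0], which is at least [t 0]. *)
have tsE : tstar t gamma = t 0.
  rewrite /tstar (@hgamma 0 (t 0)) ?min_l //.
    by have /andP[] := tau_zeta 0%N.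
  by rewrite lexx add0r; apply: (tauS 0%N).
split.
- rewrite tsE (_ : bounded_solutions _ _ _ _ = piecewise_sol tau zt A).
    exact: (piecewise_sol_homeomorphic hN tauS tau_zeta taux hnup hA hG hGp hGK).
  (* Every solution is bounded, by the forward estimate, so the two sets coincide. *)
  apply/seteqP; split=> [u [/sol_iff]//|u hu]; split; first exact/sol_iff.
  exists (expR (K / (1 - nup)) * N (u (tau 0%N))) => s; rewrite tsE.
  exact: (piecewise_sol_bound hN tauS tau_zeta taux hnup hA hG hGp hGK hu).
- move=> u /sol_iff hu.
  exact: (piecewise_sol_cvg hN tauS tau_zeta taux hnup hA hG hGp hGK hu).
- move=> uh.
  have [u [hu cu]] := piecewise_sol_cvg_exists hN tauS tau_zeta taux hnup hnum hA hG hGp hGm hGK uh.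
  exists u; split=> [|v [/sol_iff hv cv]]; first by split=> //; apply/sol_iff.
  exact: (piecewise_sol_cvg_unique hN tauS tau_zeta taux hnup hnum hA hG hGp hGm hGK hu hv cu cv).
Qed.
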